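(* Let $V_1,\dots,V_n$ be doubly commuting isometries acting on a Hilbert space $\mathcal H$. Then there corresponds an orthogonal decomposition of $\mathcal H$ into $2^n$ subspaces $\mathcal H_1,\dots,\mathcal H_{2^n}$ such that: (1) each $\mathcal H_j$, $1\le j\le 2^n$, is a joint reducing subspace for $V_1,\dots,V_n$; (2) $V_i|_{\mathcal H_j}$ is either a unitary or a pure isometry for all $i=1,\dots,n$ and $j=1,\dots,2^n$; (3) if $\mathcal F_n=\{(\mathcal A_j,\mathcal H_j):1\le j\le 2^n\}$, where $\mathcal A_j=(V_1|_{\mathcal H_j},\dots,V_n|_{\mathcal H_j})$ for each $j$, and if $\mathcal M_n$ is the set of all functions $f:\{1,\dots,n\}\to\{A1,B1\}$, then corresponding to every $g\in\mathcal M_n$ there exists a unique element $(\mathcal A_g,\mathcal H_g)\in\mathcal F_n$ such that the $k$-th component of $\mathcal A_g$ is of type $g(k)$, for $1\le k\le n$; (4) $\mathcal H_1$ is the maximal joint reducing subspace for $V_1,\dots,V_n$ such that $V_1|_{\mathcal H_1},\dots,V_n|_{\mathcal H_1}$ are unitaries; (5) $\mathcal H_{2^n}$ is the maximal joint reducing subspace for $V_1,\dots,V_n$ such that $V_1|_{\mathcal H_{2^n}},\dots,V_n|_{\mathcal H_{2^n}}$ are pure isometries. One or more members of $\{\mathcal H_j:j=1,\dots,2^n\}$ may coincide with the trivial subspace $\{0\}$.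
   Context: Operators are bounded linear operators on complex Hilbert spaces. Commuting isometries $V_1,\dots,V_n$ are doubly commuting if $V_iV_j^*=V_j^*V_i$ for all $i\neq j$. A pure isometry (unilateral shift) is an isometry $V$ with $V^{*m}h\to0$ as $m\to\infty$ for every $h$. An operator is of type $A1$ if it is a unitary and of type $B1$ if it is a pure isometry. Elements of $\mathcal F_n$ are counted with their index $j$ (so there are $2^n$ of them), each carrying an assigned list of types for its components, also when $\mathcal H_j=\{0\}$. *)

(* Defs.v *)
From HB Require Import structures.
From mathcomp Require Import all_boot all_order all_algebra.
From mathcomp Require Import complex.
From mathcomp Require Import all_classical all_reals all_analysis.
Import Order.TTheory GRing.Theory Num.Theory.
Import numFieldNormedType.Exports.

Set Implicit Arguments.
Unset Strict Implicit.
Unset Printing Implicit Defensive.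

Local Open Scope classical_set_scope.
Local Open Scope ring_scope.

(* The inner product is linear in its first argument and conjugate-linear in
   its second one. *)
HB.mixin Record isHilbert (R : realType) H of CompleteNormedModule R[i] H := {
  inner : {dot H for (@Num.conj R[i])} ;
  inner_norm : forall x : H, `|x| ^+ 2 = inner x x }.

#[short(type="hilbertType")]
HB.structure Definition Hilbert (R : realType) :=
  { H of isHilbert R H & CompleteNormedModule R[i] H }.

Section Operators.
Context {R : realType} {H : hilbertType R}.
Implicit Types (K M : set H) (T : {linear H -> H}).

Definition closed_subspace K : Prop :=
  [/\ K 0, forall (a : R[i]) (x y : H), K x -> K y -> K (a *: x + y) & closed K].

Definition orthogonal_complement K : set H :=
  [set y | forall x, K x -> inner x y = 0].

Definition invariant_under K T : Prop := forall x, K x -> K (T x).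

Definition reducing K T : Prop :=
  [/\ closed_subspace K, invariant_under K T &
      invariant_under (orthogonal_complement K) T].

(* For a closed subspace K invariant under the bounded operator T, the
   predicates below view K as a Hilbert space in its own right and speak about
   the restriction T|_K : K -> K.  In particular [adjoint_on K T] is the adjoint
   of T|_K computed inside K (it exists and is unique by the Riesz theorem; its
   values outside of K are irrelevant). *)
Definition adjoint_on K T (y : H) : H :=
  xget 0 [set z | K z /\ forall x, K x -> inner (T x) y = inner x z].

Definition adjoint T : H -> H := adjoint_on setT T.

Definition isometry_on K T : Prop :=
  invariant_under K T /\ forall x, K x -> `|T x| = `|x|.

Definition unitary_on K T : Prop :=
  [/\ invariant_under K T,
      forall x, K x -> adjoint_on K T (T x) = x &
      forall x, K x -> T (adjoint_on K T x) = x].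

Definition pure_isometry_on K T : Prop :=
  isometry_on K T /\
  forall h, K h -> iter m (adjoint_on K T) h @[m --> \oo] --> (0 : H).

Definition is_isometry T : Prop := isometry_on setT T.

Definition doubly_commuting n (V : 'I_n -> {linear H -> H}) : Prop :=
  (forall i j, V i \o V j = V j \o V i) /\
  (forall i j, i != j -> V i \o adjoint (V j) = adjoint (V j) \o V i).

Definition joint_reducing n (V : 'I_n -> {linear H -> H}) K : Prop :=
  closed_subspace K /\ forall i, reducing K (V i).

Definition orthogonal_decomposition (J : finType) (F : J -> set H) : Prop :=
  [/\ forall j, closed_subspace (F j),
      forall j k, j != k -> forall x y, F j x -> F k y -> inner x y = 0 &
      forall x, exists y : J -> H, (forall j, F j (y j)) /\ x = \sum_j y j].

Definition is_maximal (P : set H -> Prop) K : Prop :=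
  P K /\ forall M, P M -> M `<=` K.

End Operators.

Inductive op_type : Set := A1 | B1.

Definition has_type {R : realType} {H : hilbertType R} (t : op_type)
    (K : set H) (T : {linear H -> H}) : Prop :=
  match t with A1 => unitary_on K T | B1 => pure_isometry_on K T end.

Lemma pow2_gt0 n : (0 < 2 ^ n)%N.
Proof. by rewrite expn_gt0. Qed.

(* The indices of the subspaces written H_1 and H_(2^n) in 1-based notation. *)
Definition first_index n : 'I_(2 ^ n) := Ordinal (pow2_gt0 n).
Definition last_index n : 'I_(2 ^ n) := rev_ord (first_index n).

(* Main.v *)
Require Import Defs.
From HB Require Import structures.
From mathcomp Require Import all_boot all_order all_algebra.
From mathcomp Require Import complex.
From mathcomp Require Import all_classical all_reals all_analysis.
From mathcomp Require Import ring lra zify.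
Import Order.TTheory GRing.Theory Num.Theory.
Import numFieldNormedType.Exports.
Local Open Scope classical_set_scope.
Local Open Scope ring_scope.

(* For an isometry f with adjoint g, the projections f^m g^m decrease, so they
   converge strongly, and H is the orthogonal sum of U = {x | f^m g^m x = x for
   all m} and S = {x | g^m x --> 0} (Wold). A reducing subspace on which f is
   unitary (resp. a pure isometry) lies in U (resp. S), and conversely. Double
   commutation makes U and S for V_i invariant under every V_j and V_j^*, so the
   n Wold decompositions refine one another; the subspaces sought are the 2^n
   intersections with one summand chosen for each i. *)

(** Arithmetic of a minimising sequence: [p] and [q] are squared distances near the infimum [d], [r]
    is the one at the midpoint, and the left side comes from the parallelogram law. *)
Lemma midpoint_bound (R : realFieldType) (d p q r s t : R) :
  p < d + s -> q < d + t -> d <= r -> t <= s -> q *+ 2 + p *+ 2 - r *+ 4 <= s *+ 4.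
Proof. lra. Qed.

(** * Inner products, squared norms and convergence *)

Section InnerProduct.
Context {R : realType} {H : hilbertType R}.
Implicit Types (x y z : H) (a : R[i]).

Lemma innerC x y : inner x y = Num.conj (inner y x).
Proof. by rewrite hermC expr0 mul1r. Qed.

Lemma innerDl x y z : inner (x + y) z = inner x z + inner y z.
Proof. exact: linearDl. Qed.

Lemma innerDr x y z : inner x (y + z) = inner x y + inner x z.
Proof. exact: linearDr. Qed.

Lemma innerBl x y z : inner (x - y) z = inner x z - inner y z.
Proof. exact: linearBl. Qed.

Lemma innerBr x y z : inner x (y - z) = inner x y - inner x z.
Proof. exact: linearBr. Qed.

Lemma innerZl a x y : inner (a *: x) y = a * inner x y.
Proof. exact: linearZl_LR. Qed.

Lemma innerZr a x y : inner x (a *: y) = Num.conj a * inner x y.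
Proof. exact: linearZr_LR. Qed.

Lemma inner0l x : inner 0 x = 0.
Proof. exact: linear0l. Qed.

Lemma inner_orthC x y : inner x y = 0 -> inner y x = 0.
Proof. by move=> xy0; rewrite innerC xy0 rmorph0. Qed.

Lemma inner_eq0 x : inner x x = 0 -> x = 0.
Proof. by move/eqP; rewrite (@dnorm_eq0 _ H inner) => /eqP. Qed.

Lemma inner_inj x y : (forall z, inner z x = inner z y) -> x = y.
Proof.
move=> xy; apply/eqP; rewrite -subr_eq0; apply/eqP/inner_eq0.
by rewrite innerBr xy subrr.
Qed.

(** Norms and inner products take values in [R[i]]; a copy in [R] gives access to infima and
    monotone limits. *)
Definition sqnorm x : R := complex.Re (inner x x).

Lemma sqnormE x : (sqnorm x)%:C%C = inner x x.
Proof. by rewrite /sqnorm RRe_real// ger0_real// dnorm_ge0. Qed.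

Lemma sqnorm_ge0 x : 0 <= sqnorm x.
Proof. by rewrite -lecR sqnormE dnorm_ge0. Qed.

Lemma sqnormN x : sqnorm (- x) = sqnorm x.
Proof. by rewrite /sqnorm hnormN. Qed.

Lemma sqnormBC x y : sqnorm (x - y) = sqnorm (y - x).
Proof. by rewrite -sqnormN opprB. Qed.

Lemma sqnorm_norm x : `|x| ^+ 2 = (sqnorm x)%:C%C.
Proof. by rewrite inner_norm sqnormE. Qed.

Lemma eq_norm_sqnorm x y : `|x| = `|y| <-> sqnorm x = sqnorm y.
Proof.
split=> [xy|xy]; first by apply: complexI; rewrite -!sqnorm_norm xy.
by apply: (pexpIrn (n := 2)); rewrite ?nnegrE ?sqnorm_norm ?xy.
Qed.

Lemma norm_lt_sqnorm x (e : R) : 0 < e -> (`|x| < e%:C%C) = (sqnorm x < e ^+ 2).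
Proof.
move=> e0; rewrite -(@ltr_pXn2r _ 2)// ?nnegrE// ?lecR ?ltW//.
by rewrite sqnorm_norm -rmorphXn ltcR.
Qed.

Lemma norm_sqnorm x : `|x| = (Num.sqrt (sqnorm x))%:C%C.
Proof.
apply: (pexpIrn (n := 2)); rewrite ?nnegrE ?lecR ?sqrtr_ge0//.
by rewrite sqnorm_norm -rmorphXn /= sqr_sqrtr// sqnorm_ge0.
Qed.

Lemma sqnorm_parallelogram x y :
  sqnorm (x - y) = sqnorm x *+ 2 + sqnorm y *+ 2 - sqnorm (x + y).
Proof.
apply: complexI; rewrite !(rmorphB, rmorphD, rmorphMn) /= !sqnormE.
by rewrite innerBl innerDl !innerBr !innerDr; ring.
Qed.

(* The case [c = 0] is the Cauchy-Schwarz inequality. *)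
Lemma inner_normsq_le (c : R) x y : (forall a, c <= sqnorm (x - a *: y)) ->
  `|inner x y| ^+ 2 <= ((sqnorm x - c) * sqnorm y)%:C%C.
Proof.
move=> cle; have [->|y0] := eqVneq y 0.
  by rewrite linear0r normr0 expr0n /sqnorm inner0l mulr0.
have yy0 : inner y y != 0 by rewrite (@dnorm_eq0 _ H inner).
(* This coefficient [a] minimises the norm of [x - a *: y]. *)
have := cle (inner x y / inner y y); rewrite -lecR sqnormE.
rewrite innerBl !innerBr !innerZl !innerZr fmorph_div/= -!innerC.
have -> : inner x x - inner y x / inner y y * inner x y -
   (inner x y / inner y y * inner y x -
     inner x y / inner y y * (inner y x / inner y y * inner y y)) =
   inner x x - inner x y * inner y x / inner y y by field.
rewrite rmorphM rmorphB/= !sqnormE [inner y x]innerC -normCK lerBrDr -lerBrDl.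
by rewrite ler_pdivrMr// lt_def yy0 dnorm_ge0.
Qed.

Lemma inner_norm_le x y : `|inner x y| <= `|x| * `|y|.
Proof.
rewrite -(@ler_pXn2r _ 2)// ?nnegrE ?mulr_ge0//.
rewrite exprMn !sqnorm_norm -rmorphM/=.
by rewrite -[sqnorm x]subr0; apply: inner_normsq_le => a; apply: sqnorm_ge0.
Qed.

(** The order of [R[i]] only relates numbers with equal imaginary parts, so every positive epsilon
    is real. *)
Lemma complex_gt0P (e : R[i]) : 0 < e -> exists2 r : R, 0 < r & e = r%:C%C.
Proof.
by case: e => r s; rewrite ltcE/= => /andP[/eqP-> r0]; exists r.
Qed.

Lemma cvg_sqnorm (u : nat -> H) x :
  u @ \oo --> x <-> (fun m => sqnorm (u m - x)) @ \oo --> (0 : R).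
Proof.
split=> [/cvgrPdist_lt ux|/cvgrPdist_lt ux]; apply/cvgrPdist_lt => e e0.
- have se0 : 0 < Num.sqrt e by rewrite sqrtr_gt0.
  have := ux (Num.sqrt e)%:C%C; rewrite ltcR => /(_ se0).
  apply: filterS => m; rewrite distrC norm_lt_sqnorm// sqr_sqrtr ?ltW//.
  by rewrite sub0r normrN ger0_norm ?sqnorm_ge0.
- have [r r0 ->] := complex_gt0P e e0.
  have := ux (r ^+ 2); rewrite exprn_gt0// => /(_ isT).
  apply: filterS => m; rewrite norm_lt_sqnorm// sqnormBC.
  by rewrite sub0r normrN ger0_norm ?sqnorm_ge0.
Qed.

Lemma cvg0_sqnorm (u : nat -> H) :
  u @ \oo --> (0 : H) <-> sqnorm \o u @ \oo --> (0 : R).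
Proof.
rewrite cvg_sqnorm (_ : (fun m => _) = sqnorm \o u)//.
by apply/funext => m; rewrite subr0.
Qed.

Lemma sqnorm_cauchy_cvg (e : nat -> R) (u : nat -> H) :
  e @ \oo --> 0 -> (forall k m, (k <= m)%N -> sqnorm (u k - u m) <= e k) ->
  cvgn u.
Proof.
move=> /cvgrPdist_lt e0 ue; apply/cauchy_cvgP/cauchy_exP => _ /complex_gt0P[r r0 ->].
have := e0 (r ^+ 2); rewrite exprn_gt0// => /(_ isT) [N _ eN].
exists (u N); exists N => // m /= Nm; rewrite -ball_normE/= norm_lt_sqnorm//.
apply: le_lt_trans (ue _ _ Nm) _; have := eN N (leqnn N).
by rewrite /= sub0r normrN => /(le_lt_trans (ler_norm _)).
Qed.

Lemma cvg_inner (T : Type) (F : set_system T) (FF : Filter F) (u : T -> H) x y :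
  u @ F --> x -> (fun m => inner (u m) y : R[i]^o) @ F --> (inner x y : R[i]^o).
Proof.
move=> /cvgrPdist_lt ux; apply/cvgrPdist_lt => e e0.
have y1 : 0 < `|y| + 1 by rewrite ltr_pwDr.
have := ux (e / (`|y| + 1)); rewrite divr_gt0// => /(_ isT).
apply: filterS => m um; rewrite -innerBl.
apply: le_lt_trans (inner_norm_le _ _) _.
move: um; rewrite ltr_pdivlMr//; apply: le_lt_trans.
by rewrite ler_wpM2l// lerDl.
Qed.

Lemma closed_subspace_orthogonal_complement (K : set H) :
  closed_subspace (orthogonal_complement K).
Proof.
split=> [x _|a x y Kx Ky z Kz|]; first exact: linear0r.
  by rewrite innerDr innerZr Kx// Ky// mulr0 addr0.
(* [cvg_inner] gives continuity in the first argument, hence the exchange of [x] and [y] in these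
   closed preimages. *)
rewrite (_ : orthogonal_complement K =
    \bigcap_(x in K) ((fun y => inner y x : R[i]^o) @^-1` [set (0 : R[i]^o)])).
  apply: closed_bigI => x _; apply: closed_comp; last first.
    exact/accessible_closed_set1/hausdorff_accessible/norm_hausdorff.
  by move=> y _; apply: cvg_inner; apply: cvg_id.
by apply/seteqP; split=> y Ky x Kx /=; apply: inner_orthC; apply: Ky.
Qed.

Lemma closed_subspace_cvg (K : set H) (u : nat -> H) x :
  closed_subspace K -> (forall m, K (u m)) -> u @ \oo --> x -> K x.
Proof.
by move=> [_ _ Kc] Ku; apply: (@closed_cvg _ _ _ _ u K) => //; apply: nearW.
Qed.

Lemma eq0_cvg0 (u : nat -> H) (b c : R[i]) :
  0 <= b -> u @ \oo --> (0 : H) -> (forall m, `|c| <= b * `|u m|) -> c = 0.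
Proof.
move=> b0 /cvgrPdist_lt u0 cu; apply/eqP; apply: contraT => c0.
have b1 : 0 < b + 1 by rewrite ltr_pwDr.
have := u0 (`|c| / (b + 1)); rewrite divr_gt0 ?normr_gt0// => /(_ isT).
move=> [N _ /(_ N (leqnn N))]/=; rewrite sub0r normrN ltr_pdivlMr// => lt_c.
have := le_lt_trans (cu N) (le_lt_trans _ lt_c).
by rewrite ltxx => -> //; rewrite mulrC ler_wpM2l// lerDl.
Qed.

Lemma closed_subspaceZ (K : set H) a x : closed_subspace K -> K x -> K (a *: x).
Proof. by move=> [K0 Kl _] Kx; rewrite -[_ *: _]addr0; apply: Kl. Qed.

Lemma closed_subspaceD (K : set H) x y :
  closed_subspace K -> K x -> K y -> K (x + y).
Proof. by move=> [_ Kl _] Kx Ky; rewrite -[x]scale1r; apply: Kl. Qed.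

Lemma closed_subspaceB (K : set H) x y :
  closed_subspace K -> K x -> K y -> K (x - y).
Proof.
by move=> [_ Kl _] Kx Ky; rewrite addrC -scaleN1r; apply: Kl.
Qed.

(** * Polarization and Riesz representation along an isometry *)

Lemma inner_polarization (f : {linear H -> H}) (K : set H) :
  closed_subspace K -> (forall x, K x -> sqnorm (f x) = sqnorm x) ->
  forall x y, K x -> K y -> inner (f x) (f y) = inner x y.
Proof.
move=> Kc fiso x y Kx Ky.
have {}fiso z : K z -> inner (f z) (f z) = inner z z.
  by move=> Kz; rewrite -!sqnormE fiso.
have := fiso _ (closed_subspaceD _ _ _ Kc Kx (closed_subspaceZ _ 'i _ Kc Ky)).
have := fiso _ (closed_subspaceD _ _ _ Kc Kx Ky).
rewrite ![f (_ + _)]linearD ![f (_ *: _)]linearZ/=.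
rewrite !innerDl !innerDr !innerZl !innerZr !fiso//.
set p := inner (f x) (f y); set q := inner (f y) (f x).
set p' := inner x y; set q' := inner y x.
rewrite conjCi => /eqP; rewrite -subr_eq0; set A := (X in X == 0) => /eqP A0.
move=> /eqP; rewrite -subr_eq0; set B := (X in X == 0) => /eqP B0.
have i2 := sqrCi R[i].
(* [A] compares norms at [x + y], [B] at [x + 'i *: y]; in [A + 'i * B] the terms with [q] and [q']
   cancel. *)
have pE : p - p' = 2%:R^-1 * (A + 'i * B) by rewrite /A /B; field: i2.
by apply/eqP; rewrite -subr_eq0 pE A0 B0 mulr0 addr0 mulr0.
Qed.

(* A minimising sequence of [sqnorm (h - f x)] over [x] in [K] is Cauchy because
   [f] is isometric, and its limit represents [h] against the range of [f]. With
   [K = setT] this gives the adjoint of [f], with [f = id] the projection on [K]. *)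
Lemma isometry_riesz (f : {linear H -> H}) (K : set H) (h : H) :
  closed_subspace K -> (forall x, K x -> sqnorm (f x) = sqnorm x) ->
  exists2 z, K z & forall x, K x -> inner (f x) h = inner x z.
Proof.
move=> Kc fiso; pose E := [set sqnorm (h - f x) | x in K].
have Elb : has_lbound E by exists 0 => _ [x _ <-]; apply: sqnorm_ge0.
have Einf : has_inf E.
  by split=> //; exists (sqnorm (h - f 0)), 0 => //; case: Kc.
pose d := inf E.
have dle x : K x -> d <= sqnorm (h - f x) by move=> Kx; apply: ge_inf => //; exists x.
have /choice[u Ku] m : exists x, K x /\ sqnorm (h - f x) < d + harmonic m.
  have [_ [x Kx <-] lt] := inf_adherent (harmonic_gt0 m) Einf; by exists x.
have ucau k m : (k <= m)%N -> sqnorm (u k - u m) <= harmonic k *+ 4.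
  move=> km; have [Kk dk] := Ku k; have [Km dm] := Ku m.
  rewrite -fiso; last exact: closed_subspaceB.
  pose w := 2%:R^-1 *: (u k + u m).
  have Kw : K w by apply: closed_subspaceZ => //; apply: closed_subspaceD.
  have -> : f (u k - u m) = (h - f (u m)) - (h - f (u k)).
    by rewrite linearB opprB [RHS]addrC addrA subrK.
  rewrite sqnorm_parallelogram.
  have -> : (h - f (u m)) + (h - f (u k)) = 2%:R *: (h - f w).
    have fw : f (u k) + f (u m) = 2%:R *: f w.
      by rewrite -[RHS]linearZ /w scalerA divff// scale1r [RHS]linearD.
    by rewrite scalerBr -fw scaler_nat mulr2n addrACA -opprD [f (u m) + _]addrC.
  have -> : sqnorm (2%:R *: (h - f w)) = sqnorm (h - f w) *+ 4.
    by rewrite /sqnorm innerZl innerZr conjC_nat mulrA -natrM mulr_natl raddfMn.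
  apply: midpoint_bound dk dm (dle _ Kw) _.
  by rewrite lef_pV2 ?posrE// ler_nat.
have /sqnorm_cauchy_cvg/(_ ucau) : (fun k => harmonic k *+ 4 : R) @ \oo --> 0.
  rewrite -(mul0rn _ 4); apply: cvgMn; exact: cvg_harmonic.
move=> /cvg_ex[z uz]; have Kz : K z.
  by apply: closed_subspace_cvg uz => // m; case: (Ku m).
exists z => // x Kx; rewrite -(inner_polarization f K Kc fiso x z Kx Kz).
apply/eqP; rewrite -subr_eq0 -innerBr; apply/eqP/inner_orthC.
have lim_inner : (fun m => inner (h - f (u m)) (f x) : R[i]^o) @ \oo -->
    (inner (h - f z) (f x) : R[i]^o).
  apply: cvg_inner; apply/cvg_sqnorm; move/cvg_sqnorm: uz.
  apply: cvg_trans; apply: near_eq_cvg; apply: nearW => m.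
  rewrite -(fiso (u m - z)); last by apply: closed_subspaceB => //; case: (Ku m).
  by rewrite [f (_ - _)]linearB [RHS]sqnormBC opprB [in RHS]addrC addrA subrK.
(* These inner products also tend to 0: moving [u m] along [x] stays in [K] and cannot bring the
   squared distance below [d], which it exceeds by less than [harmonic m]. *)
apply: (@cvg_unique _ (@norm_hausdorff _ R[i]^o) _ _ _ _ lim_inner).
apply/cvgrPdist_lt => _ /complex_gt0P[r r0 ->].
have : (fun m => harmonic m * sqnorm x : R) @ \oo --> 0 * sqnorm x.
  by apply: cvgMl; apply: cvg_harmonic.
rewrite mul0r => /cvgrPdist_lt/(_ (r ^+ 2)); rewrite exprn_gt0// => /(_ isT).
apply: filterS => m; rewrite !sub0r !normrN => lt_r.
rewrite -(@ltr_pXn2r _ 2)// ?nnegrE ?lecR ?ltW//.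
apply: le_lt_trans (inner_normsq_le d _ _ _) _.
  move=> a; rewrite -addrA -opprD -linearZ -linearD; apply: dle.
  by rewrite addrC; apply: closed_subspaceD => //; [apply: closed_subspaceZ|case: (Ku m)].
rewrite -rmorphXn ltcR fiso//; apply: le_lt_trans lt_r.
apply: le_trans (ler_norm _); rewrite ler_wpM2r ?sqnorm_ge0// lerBlDl.
by case: (Ku m) => _ /ltW.
Qed.

End InnerProduct.

(** * Adjoint pairs and their iterates *)

Section AdjointPair.
Context {R : realType} {H : hilbertType R}.
Implicit Types (f g h : H -> H) (K : set H).

(** Stated for plain functions, since [adjoint T] is not packaged as a linear map and the relation
    must pass to iterates. *)
Definition adjoint_pair f g := forall x y, inner (f x) y = inner x (g y).

Lemma adjoint_pair_sym f g : adjoint_pair f g -> adjoint_pair g f.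
Proof. by move=> fg x y; rewrite innerC -fg -innerC. Qed.

Lemma adjoint_pairB f g : adjoint_pair f g -> {morph g : x y / x - y}.
Proof. by move=> fg x y; apply: inner_inj => z; rewrite -fg !innerBr !fg. Qed.

Lemma adjoint_pair_comm f g f' g' : adjoint_pair f g -> adjoint_pair f' g' ->
  f \o f' = f' \o f -> g \o g' = g' \o g.
Proof.
move=> fg fg' ff'; apply/funext => y; apply: inner_inj => z /=.
by rewrite -fg -fg' -fg' -fg -[f' (f z)]/((f' \o f) z) -ff'.
Qed.

Lemma adjoint_pair_iter f g m : adjoint_pair f g -> adjoint_pair (iter m f) (iter m g).
Proof.
move=> fg; elim: m => [//|m IHm] x y.
by rewrite iterS fg IHm -iterSr.
Qed.

Lemma invariant_iter K f m x : (forall y, K y -> K (f y)) -> K x -> K (iter m f x).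
Proof. by move=> fK Kx; elim: m => //= m; apply: fK. Qed.

Lemma iter_comm f h m x : f \o h = h \o f -> iter m f (h x) = h (iter m f x).
Proof.
by move=> fh; elim: m => //= m ->; rewrite -[LHS]/((f \o h) _) fh.
Qed.

Lemma sqnorm_iter_le f m x : (forall y, sqnorm (f y) <= sqnorm y) ->
  sqnorm (iter m f x) <= sqnorm x.
Proof. by move=> fle; elim: m => //= m; apply: le_trans. Qed.

(** For an isometry [f] with adjoint [g], the first set is the intersection of the ranges of all
    [f^m]. *)
Definition wold_part (t : op_type) f g : set H :=
  match t with
  | A1 => [set x | forall m, iter m f (iter m g x) = x]
  | B1 => [set x | iter m g x @[m --> \oo] --> (0 : H)]
  end.

Lemma closed_subspace_setT : closed_subspace [set: H].
Proof. by split=> //; apply: closedT. Qed.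

(** * The Wold decomposition of a single isometry *)

Section Wold.
Variables f g : H -> H.
Hypotheses (fg : adjoint_pair f g) (gf : cancel f g).

Lemma isometry_iterK m : cancel (iter m f) (iter m g).
Proof. by elim: m => // m IHm x; rewrite iterSr iterS gf IHm. Qed.

Lemma sqnorm_isometry x : sqnorm (f x) = sqnorm x.
Proof. by rewrite /sqnorm fg gf. Qed.

Lemma sqnorm_isometry_iter m x : sqnorm (iter m f x) = sqnorm x.
Proof. by elim: m => //= m; rewrite sqnorm_isometry. Qed.

(** As [g^m f^m = id], this is the orthogonal projection onto the range of [f^m]. *)
Let Q m x := iter m f (iter m g x).

Lemma inner_range_proj k m x :
  (k <= m)%N -> inner (Q m x) (Q k x) = inner (Q m x) (Q m x).
Proof.
move=> km; rewrite /Q !(adjoint_pair_iter _ _ m fg) isometry_iterK.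
by rewrite -{2}(subnK km) iterD isometry_iterK -iterD subnK.
Qed.

(** Pythagoras: the ranges decrease, so [Q k x - Q m x] is orthogonal to [Q m x]. *)
Lemma sqnorm_range_projB k m x : (k <= m)%N ->
  sqnorm (Q k x - Q m x) = sqnorm (iter k g x) - sqnorm (iter m g x).
Proof.
move=> km; rewrite -[sqnorm (iter k g x)](sqnorm_isometry_iter k).
rewrite -[sqnorm (iter m g x)](sqnorm_isometry_iter m) -/(Q _ _) -/(Q _ _).
apply: complexI; rewrite rmorphB/= !sqnormE innerBl !innerBr.
have Qkm : inner (Q k x) (Q m x) = inner (Q m x) (Q m x).
  by rewrite innerC (inner_range_proj _ _ _ km) -innerC.
by rewrite (inner_range_proj _ _ _ km) Qkm subrr subr0.
Qed.

Lemma sqnorm_coisometry_iter_decr x : nonincreasing_seq (fun m => sqnorm (iter m g x)).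
Proof. by move=> k m km; rewrite -subr_ge0 -sqnorm_range_projB// sqnorm_ge0. Qed.

Lemma sqnorm_coisometry x : sqnorm (g x) <= sqnorm x.
Proof. exact: (sqnorm_coisometry_iter_decr x 0 1). Qed.

(** The squared norms of [g^m x] decrease to a limit, and their excess over it bounds the squared
    distances to later projections. *)
Lemma cvgn_range_proj x : cvgn (Q ^~ x).
Proof.
pose a m := sqnorm (iter m g x).
have alb : has_lbound (range a) by exists 0 => _ [m _ <-]; apply: sqnorm_ge0.
have acvg := nonincreasing_is_cvgn (sqnorm_coisometry_iter_decr x) alb.
apply: (sqnorm_cauchy_cvg (fun m => a m - limn a)).
  by rewrite -(subrr (limn a)); apply: cvgB => //; apply: cvg_cst.
move=> k m km; rewrite sqnorm_range_projB// lerB//.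
exact: nonincreasing_cvgn_ge (sqnorm_coisometry_iter_decr x) acvg m.
Qed.

(** [u] is the limit of the projections [Q m x], which remain in [K]. The form relative to [K] lets
    one decomposition be carried out inside the summands of others. *)
Lemma wold_split K x : closed_subspace K -> (forall y, K y -> K (f y)) ->
    (forall y, K y -> K (g y)) -> K x ->
  exists2 u, wold_part A1 f g u /\ wold_part B1 f g (x - u) & K u /\ K (x - u).
Proof.
move=> Kc Kf Kg Kx; have /cvg_ex[u Qu] := cvgn_range_proj x.
have Ku : K u.
  apply: (closed_subspace_cvg K _ u Kc _ Qu) => m.
  by do 2!apply: invariant_iter => //.
have QB m : {morph Q m : y z / y - z}.
  move=> y z; rewrite /Q (adjoint_pairB _ _ (adjoint_pair_iter _ _ m fg)).
  exact: adjoint_pairB (adjoint_pair_sym _ _ (adjoint_pair_iter _ _ m fg)) _ _.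
have Qle m y : sqnorm (Q m y) <= sqnorm y.
  by rewrite /Q sqnorm_isometry_iter sqnorm_iter_le//; apply: sqnorm_coisometry.
have Uu : wold_part A1 f g u.
  (* For [m >= k], [Q m x = Q k (Q m x)] and [Q k] is a contraction, so [Q m x] also tends to
     [Q k u]. *)
  move=> k; apply: (@cvg_unique _ (@norm_hausdorff _ H) _ _ _ _ _ Qu).
  apply/cvg_sqnorm; move/cvg_sqnorm: Qu => Qu.
  apply: (squeeze_cvgr _ (cvg_cst 0) Qu).
  exists k => // m /= km; rewrite sqnorm_ge0/=.
  have QkQm : Q m x = Q k (Q m x).
    by rewrite /Q -{3}(subnKC km) iterD isometry_iterK -iterD subnKC.
  by rewrite {1}QkQm -QB Qle.
exists u; split=> //; last exact: closed_subspaceB.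
(* As [Q m u = u], the vectors [g^m (x - u)] and [Q m x - u] have the same norm. *)
apply/cvg0_sqnorm; move/cvg_sqnorm: Qu; apply: cvg_trans.
apply: near_eq_cvg; apply: nearW => m /=.
by rewrite -{1}[u](Uu m) -[iter m f _]/(Q m u) -QB sqnorm_isometry_iter.
Qed.

(** Moving [f^m] across in [x = f^m g^m x] bounds [inner x y] by the norm of [x] times that of
    [g^m y], which tends to 0. *)
Lemma wold_orthogonal x y :
  wold_part A1 f g x -> wold_part B1 f g y -> inner x y = 0.
Proof.
move=> Ux Sy; apply: (eq0_cvg0 _ `|x| _ _ Sy) => // m.
rewrite -(Ux m) (adjoint_pair_iter _ _ m fg).
apply: le_trans (inner_norm_le _ _) _; rewrite ler_wpM2r//.
by rewrite !norm_sqnorm lecR ler_wsqrtr// Ux sqnorm_iter_le//; apply: sqnorm_coisometry.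
Qed.

(** Each summand is the orthogonal complement of the other. *)
Lemma closed_subspace_wold_part t : closed_subspace (wold_part t f g).
Proof.
have setT_split x : exists2 u, wold_part A1 f g u & wold_part B1 f g (x - u).
  by have [//|//|//|u [Uu Sx] _] := wold_split setT x closed_subspace_setT; exists u.
have -> : wold_part t f g = orthogonal_complement
    (wold_part (if t is A1 then B1 else A1) f g).
  case: t; apply/seteqP; split=> [x tx y ty|x xt].
  - exact/inner_orthC/wold_orthogonal.
  - have [u Uu Sx] := setT_split x; suff -> : x = u by [].
    apply/eqP; rewrite -subr_eq0; apply/eqP/inner_eq0.
    by rewrite innerBr (xt _ Sx) (inner_orthC _ _ (wold_orthogonal _ _ Uu Sx)) subrr.
  - exact: wold_orthogonal.
  - have [u Uu Sx] := setT_split x; suff u0 : u = 0 by rewrite u0 subr0 in Sx.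
    apply: inner_eq0; have := wold_orthogonal _ _ Uu Sx.
    by rewrite innerBr (xt _ Uu) sub0r => /eqP; rewrite oppr_eq0 => /eqP.
exact: closed_subspace_orthogonal_complement.
Qed.

(** Double commutation enters here: [h] will be another isometry of the family or its adjoint. *)
Lemma wold_part_comm t h x : f \o h = h \o f -> g \o h = h \o g ->
  (forall y, sqnorm (h y) <= sqnorm y) ->
  wold_part t f g x -> wold_part t f g (h x).
Proof.
move=> fh gh hle; case: t => [Ux m|/cvg0_sqnorm Sx].
  by rewrite (iter_comm _ _ _ _ gh) (iter_comm _ _ _ _ fh) Ux.
apply/cvg0_sqnorm; apply: (squeeze_cvgr _ (cvg_cst 0) Sx).
by apply: nearW => m /=; rewrite sqnorm_ge0 (iter_comm _ _ _ _ gh) hle.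
Qed.

(** [f] and [g] need not commute, so [wold_part_comm] does not cover [h = f]; instead one [g]
    cancels against the extra [f]. *)
Lemma wold_part_isometry t x : wold_part t f g x -> wold_part t f g (f x).
Proof.
case: t => [Ux m|Sx]; last first.
  rewrite /= -(cvg_shiftS (fun m => iter m g (f x))).
  by under eq_fun do rewrite iterSr gf.
by case: m => // m; rewrite [iter _ g _]iterSr gf iterS Ux.
Qed.

Lemma wold_part_coisometry t x : wold_part t f g x -> wold_part t f g (g x).
Proof.
case: t => [Ux m|Sx].
  by rewrite -{2}(Ux m.+1) iterS gf -iterSr.
move: Sx; rewrite /= -(cvg_shiftS (fun m => iter m g x)).
by under eq_fun do rewrite iterSr.
Qed.

End Wold.
End AdjointPair.

(** * Adjoints and types of restrictions to reducing subspaces *)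

Section Restriction.
Context {R : realType} {H : hilbertType R}.
Implicit Types (T : {linear H -> H}) (K : set H).

Lemma is_isometry_sqnorm T : is_isometry T -> forall x, sqnorm (T x) = sqnorm x.
Proof. by move=> [_ Tiso] x; apply/eq_norm_sqnorm/Tiso. Qed.

(** [isometry_riesz] shows that the set from which [adjoint] chooses is inhabited, so the default 0
    of [xget] is not taken. *)
Lemma adjoint_pair_adjoint T : is_isometry T -> adjoint_pair T (adjoint T).
Proof.
move=> /is_isometry_sqnorm Tiso x y; rewrite /adjoint /adjoint_on.
have [//|z _ Tz] := isometry_riesz T setT y closed_subspace_setT.
by case: xgetP => [_ _ [_ ->]//|/(_ z)[]].
Qed.

Lemma adjointK T : is_isometry T -> cancel T (adjoint T).
Proof.
move=> Tiso x; apply: inner_inj => z; rewrite -adjoint_pair_adjoint//.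
apply: inner_polarization closed_subspace_setT _ _ _ _ _ => // y _.
exact: is_isometry_sqnorm.
Qed.

Lemma reducing_adjoint_pair K T g : closed_subspace K -> adjoint_pair T g ->
  (forall x, K x -> K (T x)) -> (forall x, K x -> K (g x)) -> reducing K T.
Proof.
move=> Kc Tg KT Kg; split=> // x xK y Ky.
by apply: inner_orthC; rewrite Tg; apply: inner_orthC; apply: xK; apply: Kg.
Qed.

(** With [z] the projection of [g y] on [K], the difference [g y - z] lies in the complement of [K],
    which [T] preserves; it is thus orthogonal to both [g y] and [z], and vanishes. *)
Lemma reducing_adjoint K T g y : reducing K T -> adjoint_pair T g -> K y ->
  K (g y).
Proof.
move=> [Kc KT KT'] Tg Ky.
have [//|z Kz gz] := isometry_riesz idfun K (g y) Kc.
suff -> : g y = z by [].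
have Kz' : orthogonal_complement K (g y - z).
  by move=> x Kx; rewrite innerBr gz// subrr.
apply/eqP; rewrite -subr_eq0; apply/eqP/inner_eq0; rewrite {1}innerBr -Tg.
rewrite (inner_orthC _ _ (KT' _ Kz' _ Ky)) sub0r.
by rewrite (inner_orthC _ _ (Kz' _ Kz)) oppr0.
Qed.

(** [g y] lies in [K] and satisfies the defining equation; two solutions differ by a vector of [K]
    orthogonal to itself. *)
Lemma adjoint_onE K T g y : reducing K T -> adjoint_pair T g -> K y ->
  adjoint_on K T y = g y.
Proof.
move=> Kred Tg Ky; have Kgy := reducing_adjoint _ _ _ _ Kred Tg Ky.
apply: xget_subset1 => [|u v [Ku Tu] [Kv Tv]]; first by split=> // x _; apply: Tg.
have [Kc _ _] := Kred; apply/eqP; rewrite -subr_eq0; apply/eqP/inner_eq0.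
have Kuv := closed_subspaceB _ _ _ Kc Ku Kv.
by rewrite innerBr -Tu// -Tv// subrr.
Qed.

(** The adjoint inside [K] is the restriction of the ambient one, so the iterates agree on [K]. Both
    the types and the maximality of the intersections follow from this criterion. *)
Lemma has_typeP K T t : is_isometry T -> reducing K T ->
  has_type t K T <-> K `<=` wold_part t T (adjoint T).
Proof.
move=> Tiso Kred; have Tg := adjoint_pair_adjoint _ Tiso.
have gT := adjointK _ Tiso; have [Kc KT _] := Kred.
have adjE y : K y -> adjoint_on K T y = adjoint T y by apply: adjoint_onE.
have Kg y : K y -> K (adjoint T y) by apply: reducing_adjoint Kred Tg.
have iterE m y : K y -> iter m (adjoint_on K T) y = iter m (adjoint T) y.
  elim: m => //= m IHm Ky; rewrite IHm// adjE//.
  exact: invariant_iter.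
case: t => /=; split.
- move=> [_ _ Tadj] x Kx; elim=> // m IHm.
  rewrite iterSr iterS -(adjE (iter m _ x)) ?Tadj//; exact: invariant_iter.
- move=> KU; split=> // x Kx; first by rewrite adjE ?gT//; apply: KT.
  by rewrite adjE//; apply: (KU _ Kx 1%N).
- move=> [_ pure] x Kx; have := pure _ Kx.
  by under eq_fun do rewrite iterE//.
- move=> KS; split; first by split=> // x _; apply: Tiso.2.
  by move=> x Kx; under eq_fun do rewrite iterE//; apply: KS.
Qed.

End Restriction.

(** * Binary digits as lists of types *)

Definition bit_type (b : bool) : op_type := if b then B1 else A1.

(** The induction splits off the lowest digit; [b] is defined on all of [nat] so that it can be
    shifted. *)
Lemma bits_unique n (b : nat -> bool) :
  exists! j, (j < 2 ^ n)%N /\ forall k, (k < n)%N -> odd (j %/ 2 ^ k) = b k.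
Proof.
elim: n b => [|n IHn] b; first by exists 0%N; split=> // -[|j] [].
have [j [[jn jb] juniq]] := IHn (b \o succn).
exists (b 0%N + j.*2)%N; split.
  split=> [|[|k] kn]; first by rewrite expnS; case: (b 0%N); lia.
    by rewrite divn1 oddD odd_double addbF oddb.
  by rewrite expnS divnMA divn2 half_bit_double jb.
move=> i [iN ib]; rewrite -[RHS](odd_double_half i) -(ib 0%N)// divn1.
congr (_ + _.*2)%N; apply: juniq; split.
  by rewrite ltn_half_double; move: iN; rewrite expnS; lia.
by move=> k kn; rewrite -divn2 -divnMA -expnS ib.
Qed.

Lemma odd_pow2_pred n k : (k < n)%N -> odd ((2 ^ n - 1) %/ 2 ^ k).
Proof.
elim: n k => // n IHn [|k] kn.
  by rewrite divn1 oddB ?expn_gt0// oddX.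
rewrite !expnS divnMA (_ : (2 * 2 ^ n - 1) %/ 2 = 2 ^ n - 1)%N ?IHn//.
by have := expn_gt0 2 n; lia.
Qed.

(** * Intersecting the Wold summands of all the isometries *)

Theorem theorem4p5 (R : realType) (H : hilbertType R) (n : nat)
    (V : 'I_n -> {linear H -> H})
    (V_isometry : forall i, is_isometry (V i))
    (V_doubly_commuting : doubly_commuting V) :
  exists (Hs : 'I_(2 ^ n) -> set H) (types : 'I_(2 ^ n) -> 'I_n -> op_type),
    orthogonal_decomposition Hs /\
    (* (1) *)
    (forall j, joint_reducing V (Hs j)) /\
    (* (2) *)
    (forall i j, unitary_on (Hs j) (V i) \/ pure_isometry_on (Hs j) (V i)) /\
    (* (3) *)
    (forall j k, has_type (types j k) (Hs j) (V k)) /\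
    (forall g : 'I_n -> op_type, exists! j, forall k, types j k = g k) /\
    (* (4) *)
    is_maximal
      (fun K => joint_reducing V K /\ forall i, unitary_on K (V i))
      (Hs (first_index n)) /\
    (* (5) *)
    is_maximal
      (fun K => joint_reducing V K /\ forall i, pure_isometry_on K (V i))
      (Hs (last_index n)).
Proof.
have [Vcomm Vdcomm] := V_doubly_commuting.
pose a i := adjoint (V i); pose part t i := wold_part t (V i) (a i).
have Va i : adjoint_pair (V i) (a i) by apply: adjoint_pair_adjoint.
have aV i : cancel (V i) (a i) by apply: adjointK.
have part_closed t i : closed_subspace (part t i).
  exact: closed_subspace_wold_part (Va i) (aV i) t.
(* For [j != i], [V j] commutes with [V i] and, by double commutation, with [a i]. *)
have part_V t i j x : part t i x -> part t i (V j x).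
  have [->|ij] := eqVneq j i; first exact: wold_part_isometry.
  apply: wold_part_comm => [||y]; [exact: Vcomm|exact/esym/Vdcomm|].
  by rewrite is_isometry_sqnorm.
have part_a t i j x : part t i x -> part t i (a j x).
  have [->|ij] := eqVneq j i; first exact: wold_part_coisometry.
  apply: wold_part_comm => [||y]; first by apply: Vdcomm; rewrite eq_sym.
    exact: adjoint_pair_comm (Va i) (Va j) (Vcomm i j).
  exact: sqnorm_coisometry (Va j) (aV j) y.
(* Digit [k] of [j] gives the type of the component with index [k], so index 0 is all unitary and
   [2 ^ n - 1] all pure. *)
pose types (j : 'I_(2 ^ n)) (k : 'I_n) := bit_type (odd (j %/ 2 ^ k)).
have types_unique g : exists! j, forall k, types j k = g k.
  pose b k := if insub k is Some i then (if g i is B1 then true else false) else false.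
  have bE (k : 'I_n) : bit_type (b k) = g k.
    by rewrite /b valK; case: (g k).
  have [j [[jn jb] juniq]] := bits_unique n b.
  exists (Ordinal jn); split=> [k|i ig]; first by rewrite /types jb.
  apply: val_inj; apply: juniq; split=> [|k kn]; first exact: ltn_ord.
  have := ig (Ordinal kn); rewrite -bE /types /=.
  by case: (odd _); case: (b k).
pose inter (g : 'I_n -> op_type) : set H := [set x | forall i, part (g i) i x].
have inter_reducing g : joint_reducing V (inter g).
  have gc : closed_subspace (inter g).
    split=> [i|c x y gx gy i|]; first by case: (part_closed (g i) i).
      by have [_ + _] := part_closed (g i) i; apply.
    rewrite (_ : inter g = \bigcap_(i in setT) part (g i) i).
      by apply: closed_bigI => i _; have [] := part_closed (g i) i.
    by apply/seteqP; split=> x gx i; [move=> _|]; apply: gx.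
  split=> // i; apply: reducing_adjoint_pair gc (Va i) _ _ => x gx j.
    exact/part_V/gx.
  exact/part_a/gx.
(* With [g] constant this yields both maximality clauses. *)
have maximal g M : joint_reducing V M -> (forall i, has_type (g i) M (V i)) ->
    M `<=` inter g.
  move=> [_ Mred] Mg x Mx i.
  by have /(_ x Mx) := (has_typeP _ _ _ (V_isometry i) (Mred i)).1 (Mg i).
have inter_type g i : has_type (g i) (inter g) (V i).
  apply/has_typeP => //; first by case: (inter_reducing g).
  by move=> x; apply.
exists (inter \o types), types; split.
  split=> [j|j k jk x y jx ky|x].
  - by case: (inter_reducing (types j)).
  (* Distinct indices differ at some [i], where one vector is in the unitary and the other in the
     pure summand of [V i]. *)
  - have /existsNP[i ti] : ~ forall i, types j i = types k i.
      have [l [_ luniq]] := types_unique (types k).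
      move=> tjk; move/eqP: jk; apply.
      by rewrite -(luniq j tjk) -(luniq k).
    have := jx i; have := ky i; move: ti.
    case: (types j i); case: (types k i) => // _ yi xi.
      exact: wold_orthogonal (Va i) (aV i) _ _ xi yi.
    exact/inner_orthC/(wold_orthogonal _ _ (Va i) (aV i) _ _ yi xi).
  pose total x := exists y : 'I_(2 ^ n) -> H,
    (forall j, inter (types j) (y j)) /\ x = \sum_j y j.
  have totalD u v : total u -> total v -> total (u + v).
    move=> [y [yH ->]] [z [zH ->]]; exists (fun j => y j + z j).
    split=> [j|]; last by rewrite big_split.
    apply: (closed_subspaceD (inter (types j))) => //.
    by case: (inter_reducing (types j)).
  (* [g] prescribes the summands containing [u] for coordinates from [k] on. At [k = n] nothing is
     required; at [k = 0] the vector lies in [inter g]. *)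
  suff split_from k g u : (forall i : 'I_n, (k <= i)%N -> part (g i) i u) -> total u.
    by apply: (split_from n (fun=> A1)) => i; rewrite leqNgt ltn_ord.
  elim: k g u => [|k IHk] g u gu.
    have [j [jg _]] := types_unique g.
    exists (fun l => if l == j then u else 0); split=> [l|].
      case: eqP => [-> i|_]; first by rewrite jg; apply: gu.
      by have [[]] := inter_reducing (types l).
    by rewrite -big_mkcond big_pred1_eq.
  have [kn|nk] := ltnP k n; last first.
    by apply: (IHk g) => i ki; have := ltn_ord i; rewrite ltnNge (leq_trans nk ki).
  pose i0 := Ordinal kn.
  (* The conditions above [k] define a closed subspace invariant under [V i0] and [a i0], inside
     which [u] is split. *)
  pose K : set H := [set w | forall i : 'I_n, (k < i)%N -> part (g i) i w].
  have Kc : closed_subspace K.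
    split=> [i _|c x0 y xK yK i ki|]; first by case: (part_closed (g i) i).
      by have [_ + _] := part_closed (g i) i; apply; [apply: xK|apply: yK].
    rewrite (_ : K = \bigcap_(i in [set i : 'I_n | (k < i)%N]) part (g i) i)//.
    by apply: closed_bigI => i _; have [] := part_closed (g i) i.
  have [||//|w [wU wS] [wK wK']] := wold_split _ _ (Va i0) (aV i0) K u Kc.
  - by move=> y yK i ki; apply: part_V; apply: yK.
  - by move=> y yK i ki; apply: part_a; apply: yK.
  (* [u - w] is in the pure and [w] in the unitary summand at [i0]; [g] is updated there
     accordingly. *)
  rewrite -(subrK w u); apply: totalD.
    apply: (IHk (fun i => if i == i0 then B1 else g i)) => i.
    have [->//|ne] := eqVneq i i0; rewrite leq_eqVlt => /orP[/eqP ki|/wK'//].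
    by case/eqP: ne; apply: val_inj.
  apply: (IHk (fun i => if i == i0 then A1 else g i)) => i.
  have [->//|ne] := eqVneq i i0; rewrite leq_eqVlt => /orP[/eqP ki|/wK//].
  by case/eqP: ne; apply: val_inj.
split=> [j|]; first exact: inter_reducing.
split=> [i j|]; first by have := inter_type (types j) i; case: (types j i); [left|right].
split=> [j k|]; first exact: inter_type.
split=> //; split.
  have t1 i : types (first_index n) i = A1 by rewrite /types div0n.
  have t1E : types (first_index n) = fun=> A1 by apply/funext.
  rewrite /= t1E; split=> [|M [Mred Mt]]; last exact: (maximal (fun=> A1)).
  by split=> // i; apply: (inter_type (fun=> A1)).
have t1 i : types (last_index n) i = B1.
  by rewrite /types /= subn1 -subn1 odd_pow2_pred.
have t1E : types (last_index n) = fun=> B1 by apply/funext.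
rewrite /= t1E; split=> [|M [Mred Mt]]; last exact: (maximal (fun=> B1)).
by split=> // i; apply: (inter_type (fun=> B1)).
Qed.
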